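(* Let $\mathbb{V}$ be a vector space of dimension $n$ over a finite field $\mathbb{F}$ with $q$ elements, with basis $\{b_1,b_2,\ldots,b_n\}$, and let $\Gamma(\mathbb{V})$ be its non-zero component graph with respect to this basis. (a) If $q=2$ and $n\ge 3$, then $\lambda(\Gamma(\mathbb{V}))=n$. (b) If $q\ge 3$, then $\lambda(\Gamma(\mathbb{V}))=\sum_{i=1}^{n}\binom{n}{i}\left((q-1)^i-1\right)$.
   Context: Non-zero component graph: given a finite-dimensional vector space $\mathbb{V}$ over $\mathbb{F}$ with basis $\{b_1,\ldots,b_n\}$ ($n\ge 1$), $\Gamma(\mathbb{V})$ is the simple graph whose vertices are the non-zero vectors of $\mathbb{V}$; two distinct vertices are adjacent if and only if there is some $b_i$ that has non-zero coefficient in the unique linear combinations (with respect to the basis) of both. For a graph $\Gamma$ and a vertex $u$, $N(u)=\{v\in V(\Gamma): uv\in E(\Gamma)\}$ is the open neighborhood. A set $L_D\subseteq V(\Gamma)$ is a locating-dominating set for $\Gamma$ if for every two distinct vertices $u,v\in V(\Gamma)\setminus L_D$ we have $\emptyset\ne N(u)\cap L_D\ne N(v)\cap L_D\ne\emptyset$ (i.e. both intersections are non-empty and they are different from each other). The location-domination number $\lambda(\Gamma)$ is the minimum cardinality of a locating-dominating set of $\Gamma$. *)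

(* Defs.v *)
From HB Require Import structures.
From mathcomp Require Import all_boot all_order all_algebra all_field.

Set Implicit Arguments.
Unset Strict Implicit.
Unset Printing Implicit Defensive.

Import GRing.Theory.

Record sgraph := SGraph {
  vertex :> finType;
  adj : rel vertex;
  adj_sym : symmetric adj;
  adj_irr : irreflexive adj
}.

Definition nbhd (G : sgraph) (u : G) : {set G} := [set v | adj u v].

(* The condition constrains only pairs of distinct vertices outside L, so a set
   missing at most one vertex qualifies. *)
Definition locating_dominating (G : sgraph) (L : {set G}) : bool :=
  [forall u : G, forall v : G,
     [&& u != v, u \notin L & v \notin L] ==>
     [&& nbhd u :&: L != set0,
         nbhd u :&: L != nbhd v :&: L
       & nbhd v :&: L != set0]].

Lemma locating_dominatingT (G : sgraph) : locating_dominating [set: G].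
Proof. by apply/forallP=> u; apply/forallP=> v; rewrite !in_setT andbF. Qed.

(* [set: G] only serves as the initial candidate that [arg min] requires; it is
   admissible by locating_dominatingT. *)
Definition location_number (G : sgraph) : nat :=
  #|[arg min_(L < [set: G] | locating_dominating L) #|L| ]|.

Lemma location_number_spec (G : sgraph) :
  (exists2 L : {set G}, locating_dominating L & #|L| = location_number G) /\
  (forall L : {set G}, locating_dominating L -> location_number G <= #|L|).
Proof.
rewrite /location_number; case: arg_minnP; first exact: locating_dominatingT.
by move=> L LD minL; split=> //; exists L.
Qed.

Section NonZeroComponentGraph.

Local Open Scope ring_scope.

(* coord b i v is the i-th coefficient of v on b when b is a basis. *)
Definition nzc_adj (F : fieldType) (V : vectType F) (n : nat)
    (b : n.-tuple V) : rel V :=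
  fun u v =>
    (u != v) && [exists i : 'I_n, (coord b i u != 0) && (coord b i v != 0)].

Variables (F : finFieldType) (V : vectType F) (n : nat) (b : n.-tuple V).

(* finvect_type V is V itself, with its finType structure over a finite field. *)
Definition nzvector : finType := {v : finvect_type V | v != 0}.

Definition nzc_rel : rel nzvector :=
  fun u v => nzc_adj b (val u : V) (val v : V).

Lemma nzc_rel_sym : symmetric nzc_rel.
Proof.
move=> u v; rewrite /nzc_rel /nzc_adj eq_sym; congr (_ && _).
by apply: eq_existsb => i; rewrite andbC.
Qed.

Lemma nzc_rel_irr : irreflexive nzc_rel.
Proof. by move=> u; rewrite /nzc_rel /nzc_adj eqxx. Qed.

Definition nzc_graph : sgraph := SGraph nzc_rel_sym nzc_rel_irr.

End NonZeroComponentGraph.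

(* Main.v *)
(* Vertices with the same support are adjacent to the same other vertices, so a
   locating-dominating set misses at most one vertex of each support, hence at
   most 2 ^ n - 1 vertices.  Conversely a set that contains a vertex supported
   on {i} for every i, and misses at most one vertex of each support, is
   locating-dominating.  For q >= 3 the vectors having a coefficient outside
   {0, 1} form such a set, of size q ^ n - 2 ^ n.  For q = 2 the basis is such a
   set, and a smaller set L is impossible since distinct vertices outside L have
   distinct non-empty traces on L. *)
Require Import Defs.
From HB Require Import structures.
From mathcomp Require Import all_boot all_order all_algebra all_field.
From mathcomp Require Import zify.

Set Implicit Arguments.
Unset Strict Implicit.
Unset Printing Implicit Defensive.

Import GRing.Theory.

(** The map [u] to [nbhd u :&: L] injects [~: L] into the non-empty subsets of [L]. A second vertex
    outside [L] is required because a lone one is unconstrained and may have an empty trace. *)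
Lemma locating_dominating_trace_bound (G : sgraph) (L : {set G}) :
  locating_dominating L -> 1 < #|~: L| -> #|~: L| < 2 ^ #|L|.
Proof.
move=> LD /card_gt1P[x [y [xL yL xy]]].
have traceP u v : u \in ~: L -> v \in ~: L -> u != v ->
    [&& nbhd u :&: L != set0, nbhd u :&: L != nbhd v :&: L
      & nbhd v :&: L != set0].
  rewrite !inE => uL vL uv.
  by move/forallP/(_ u)/forallP/(_ v)/implyP: LD; apply; rewrite uv uL vL.
have trace_inj : {in ~: L &, injective (fun u => nbhd u :&: L)}.
  move=> u v uL vL eq_uv; apply/eqP; apply: contraT => /(traceP u v uL vL).
  by rewrite eq_uv eqxx andbF.
have trace_neq0 u : u \in ~: L -> nbhd u :&: L != set0.
  move=> uL; have [eq_ux|/(traceP u x uL xL)/and3P[]//] := eqVneq u x.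
  by rewrite eq_ux; have /and3P[] := traceP x y xL yL xy.
rewrite -(card_in_imset trace_inj) -card_powerset (cardsD1 set0 (powerset L)).
rewrite powersetE sub0set add1n ltnS; apply/subset_leq_card/subsetP=> S.
by case/imsetP=> u uL ->; rewrite !inE subsetIr trace_neq0.
Qed.

(** Binomial expansions of ((q - 1) + 1)^n and (1 + 1)^n, whose terms at i = 0 cancel. *)
Lemma sum_bin_pred_exp (n q : nat) : 0 < q ->
  \sum_(1 <= i < n.+1) 'C(n, i) * ((q - 1) ^ i - 1) = q ^ n - 2 ^ n.
Proof.
move=> q_gt0.
have bin_exp m : m.+1 ^ n = \sum_(0 <= i < n.+1) 'C(n, i) * m ^ i.
  rewrite -addn1 addnC expnDn big_mkord; apply: eq_bigr => i _.
  by rewrite exp1n mul1n.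
rewrite -{2}(prednK q_gt0) subn1 bin_exp (bin_exp 1).
rewrite [in RHS]big_ltn // [X in _ - X]big_ltn // !expn0 subnDl.
(* At q = 1 the differences 0^i - 1 are truncated, so the sum cannot be split; both sides are 0. *)
have [q1|q1] := posnP q.-1.
  rewrite q1 big_nat big1 => [|i /andP[i1 _]]; last by rewrite exp0n // muln0.
  rewrite [X in X - _]big_nat big1 // => i /andP[i1 _].
  by rewrite exp0n // muln0.
rewrite -sumnB => [|i _].
  by apply: eq_bigr => i _; rewrite mulnBr exp1n.
by rewrite leq_mul2l exp1n expn_gt0 q1 orbT.
Qed.

Section Support.

Variables (F : finFieldType) (V : vectType F) (n : nat) (b : n.-tuple V).
Hypothesis b_basis : basis_of {:V} b.

Let G := nzc_graph b.

Definition nzsupp (v : G) : {set 'I_n} :=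
  [set i | coord b i (val v : V) != 0%R].

Lemma adj_nzsupp (u v : G) :
  adj u v = (u != v) && (nzsupp u :&: nzsupp v != set0).
Proof.
rewrite /= /nzc_rel /nzc_adj; congr (_ && _).
apply/existsP/set0Pn => -[i]; first by exists i; rewrite !inE.
by rewrite !inE; exists i.
Qed.

Lemma nzvector_coord_inj (u v : G) :
  (forall i, coord b i (val u : V) = coord b i (val v : V)) -> u = v.
Proof.
move=> eq_uv; apply: val_inj.
rewrite (coord_basis b_basis (memvf (val u : V))).
rewrite [RHS](coord_basis b_basis (memvf (val v : V))).
by apply: eq_bigr => i _; rewrite eq_uv.
Qed.

Lemma nzvector_of_coord (f : 'I_n -> F) i :
  f i != 0%R -> exists v : G, forall j, coord b j (val v : V) = f j.
Proof.
move=> fi; pose w : V := (\sum_(j < n) f j *: b`_j)%R.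
have coord_w j : coord b j w = f j.
  by rewrite coord_sum_free // (basis_free b_basis).
have w0 : (w : finvect_type V) != 0%R.
  by apply: contra fi => /eqP w0; rewrite -(coord_w i) w0 linear0.
by exists (Sub (w : finvect_type V) w0).
Qed.

Lemma nzsupp_neq0 (v : G) : nzsupp v != set0.
Proof.
apply/set0Pn/existsP; apply: contraT; rewrite negb_exists => /forallP v0.
have /negP[] := valP v; apply/eqP.
rewrite (coord_basis b_basis (memvf (val v : V))) big1 // => i _.
by move: (v0 i); rewrite inE negbK => /eqP->; rewrite scale0r.
Qed.

Lemma card_nzvector : #|G| = (#|F| ^ n).-1.
Proof.
rewrite /= card_sig cardC1.
rewrite -(@card_vspacef F _ (Vector.class (finvect_type V))) card_vspace.
by rewrite [\dim _](size_basis b_basis).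
Qed.

(** A vertex outside [L] differs from every vertex of [L], so its adjacency to them depends on its
    support alone. *)
Lemma locating_dominating_nzsupp_inj (L : {set G}) :
  locating_dominating L -> {in ~: L &, injective nzsupp}.
Proof.
move=> LD u v; rewrite !inE => uL vL eq_uv; apply/eqP; apply: contraT => uv.
move/forallP/(_ u)/forallP/(_ v)/implyP: LD; rewrite uv uL vL.
move=> /(_ isT)/and3P[_ /eqP neq_uv _]; case: neq_uv.
apply/setP=> w; rewrite !inE.
have [wL|] := boolP (w \in L); rewrite ?andbF // !andbT.
have neqw x : x \notin L -> x != w by apply: contra => /eqP->.
by rewrite !adj_nzsupp eq_uv !neqw.
Qed.

(** The vertex of [L] supported on {i} lies in the trace of [u] exactly when i is in the support of
    [u], so the trace determines the support. *)
Lemma nzsupp_inj_locating_dominating (L : {set G}) :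
    {in ~: L &, injective nzsupp} ->
    (forall i, exists2 w, w \in L & nzsupp w = [set i]) ->
  locating_dominating L.
Proof.
move=> supp_inj singleL.
have trace i : exists2 w, w \in L &
    forall u : G, u \notin L -> (w \in nbhd u :&: L) = (i \in nzsupp u).
  have [w wL suppw] := singleL i; exists w => // u uL.
  rewrite !inE wL andbT adj_nzsupp suppw.
  rewrite setI_eq0 disjoint_sym disjoints1 negbK inE andb_idl // => _.
  by apply: contra uL => /eqP->.
have trace0 (u : G) : u \notin L -> nbhd u :&: L != set0.
  have /set0Pn[i iu] := nzsupp_neq0 u; have [w _ wP] := trace i.
  by move=> uL; apply/set0Pn; exists w; rewrite wP.
apply/forallP=> u; apply/forallP=> v; apply/implyP=> /and3P[uv uL vL].
rewrite !trace0 //= andbT; apply: contra uv => /eqP eq_uv.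
apply/eqP/supp_inj; rewrite ?inE //; apply/setP=> i.
by have [w _ wP] := trace i; rewrite -!wP // eq_uv.
Qed.

Lemma card_nonempty_sets : #|~: [set set0 : {set 'I_n}]| = (2 ^ n).-1.
Proof. by rewrite cardsC1 -cardsT -powersetT card_powerset cardsT card_ord. Qed.

Lemma nzsupp_inj_card (A : {set G}) :
  {in A &, injective nzsupp} -> #|A| <= (2 ^ n).-1.
Proof.
move=> A_inj; rewrite -card_nonempty_sets -(card_in_imset A_inj).
by apply/subset_leq_card/subsetP=> S /imsetP[v _ ->]; rewrite !inE nzsupp_neq0.
Qed.

Lemma nzvector_of_single (c : F) i : c != 0%R ->
  exists2 w : G, nzsupp w = [set i] & coord b i (val w : V) = c.
Proof.
move=> c0.
have [|w wP] := @nzvector_of_coord (fun j => if j == i then c else 0%R) i.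
  by rewrite eqxx.
exists w; last by rewrite wP eqxx.
by apply/setP=> j; rewrite !inE wP; case: (j =P i); rewrite ?c0 ?eqxx.
Qed.

Lemma location_number_card2 : #|F| = 2 -> 3 <= n -> location_number G = n.
Proof.
move=> F2 n3; have [[L LD cardL] minG] := location_number_spec G.
have F01 (c : F) : c != 0%R -> c = 1%R.
  move=> c0; apply/eqP; apply: contraT => c1.
  have: #|[set c; 0%R; 1%R]| <= #|F| by apply: max_card.
  by rewrite F2 -setUA cardsU1 cards2 !inE negb_or c0 c1 eq_sym oner_neq0.
have supp_inj : injective nzsupp.
  move=> u v eq_uv; apply: nzvector_coord_inj => i.
  move/setP/(_ i): eq_uv; rewrite !inE.
  by case: eqVneq => [->|/F01->]; case: eqVneq => [->|/F01->].
apply/eqP; rewrite eqn_leq; apply/andP; split.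
  (* With 1 as the only non-zero scalar, these are the basis vectors; they are counted through their
     supports. *)
  pose B : {set G} := [set v | #|nzsupp v| == 1].
  have LDB : locating_dominating B.
    apply: nzsupp_inj_locating_dominating => [|i]; first exact: in2W.
    have [w suppw _] := nzvector_of_single i (oner_neq0 F).
    by exists w; rewrite // inE suppw cards1.
  apply: leq_trans (minG _ LDB) _.
  rewrite -(card_imset _ supp_inj) -[leqRHS]bin1.
  rewrite -[X in 'C(X, _)]card_ord -card_draws.
  by apply/subset_leq_card/subsetP=> S /imsetP[v + ->]; rewrite !inE.
rewrite -cardL leqNgt; apply/negP=> Ln.
have cardLC : #|~: L| = (2 ^ n).-1 - #|L|.
  by rewrite cardsCs setCK card_nzvector F2.
(* The trace bound would give 2^n - 1 - |L| < 2^(n-1), hence 2^(n-1) < |L| + 1 <= n. The inequality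
   contradicting this fails at n = 2 and holds from n = 3 on. *)
have n_lt : n < 2 ^ n.-1.
  case: (n) n3 => [|[|[|m]]] // _; elim: m => // m IHm.
  by rewrite expnS mul2n -addnn -addn1 leq_add // expn_gt0.
have exp_n : 2 ^ n = 2 ^ n.-1 + 2 ^ n.-1.
  by rewrite addnn -mul2n -expnS prednK // (leq_trans _ n3).
have exp_L : 2 ^ #|L| <= 2 ^ n.-1.
  by rewrite leq_exp2l // -ltnS prednK // (leq_trans _ n3).
have := locating_dominating_trace_bound LD.
rewrite cardLC exp_n; lia.
Qed.

Lemma location_number_card_ge3 :
  3 <= #|F| -> location_number G = #|F| ^ n - 2 ^ n.
Proof.
move=> F3; have [[L LD cardL] minG] := location_number_spec G.
(* The multiples of the basis vectors by [c] will put a vertex of each singleton support into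
   [B]. *)
have [c cP] : exists c : F, c \notin [set 0%R; 1%R].
  apply/existsP; apply: contraLR F3; rewrite negb_exists => /forallP F01.
  rewrite -ltnNge ltnS (leq_trans _ (_ : #|[set (0%R : F); 1%R]| <= 2)) //.
    by apply/subset_leq_card/subsetP=> c _; rewrite -[_ \in _]negbK.
  by rewrite cards2; case: (_ != _).
have c0 : c != 0%R by apply: contra cP => /eqP->; rewrite !inE eqxx.
(* Used to simplify (q^n - 1) - (2^n - 1) to q^n - 2^n. *)
have exp2_gt0 : 0 < 2 ^ n by rewrite expn_gt0.
have cardG (A : {set G}) : #|A| + #|~: A| = (#|F| ^ n).-1.
  by rewrite cardsC card_nzvector.
apply/eqP; rewrite eqn_leq; apply/andP; split.
  pose B := [set v : G |
    [exists i, coord b i (val v : V) \notin [set 0%R; 1%R]]].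
  (* Outside [B] a vector is the indicator of its support. *)
  have inBC v : v \in ~: B ->
      forall i, coord b i (val v : V) = (i \in nzsupp v)%:R%R.
    rewrite !inE negb_exists => /forallP vB i; move: (vB i); rewrite !inE negbK.
    by case/orP=> /eqP->; rewrite ?eqxx ?oner_neq0.
  have LDB : locating_dominating B.
    apply: nzsupp_inj_locating_dominating => [u v uB vB eq_uv | i].
      by apply: nzvector_coord_inj => i; rewrite !inBC // eq_uv.
    have [w suppw coordw] := nzvector_of_single i c0.
    by exists w; rewrite // inE; apply/existsP; exists i; rewrite coordw.
  (* Every non-empty set is the support of its indicator vector, which lies outside [B]. *)
  have BC : (2 ^ n).-1 <= #|~: B|.
    rewrite -card_nonempty_sets.
    apply: leq_trans (leq_imset_card nzsupp (mem (~: B))).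
    apply/subset_leq_card/subsetP=> S; rewrite !inE => /set0Pn[i iS].
    have [|v vP] := @nzvector_of_coord (fun j => (j \in S)%:R%R) i.
      by rewrite iS oner_neq0.
    apply/imsetP; exists v.
      rewrite !inE; apply/existsP=> -[j]; rewrite vP !inE.
      by case: (j \in S); rewrite eqxx ?orbT.
    by apply/setP=> j; rewrite inE vP; case: (j \in S);
      rewrite ?oner_neq0 ?eqxx.
  by apply: leq_trans (minG _ LDB) _; have := cardG B; lia.
have := nzsupp_inj_card (locating_dominating_nzsupp_inj LD).
by have := cardG L; lia.
Qed.

End Support.

Theorem theorem2p7 (F : finFieldType) (q : nat) (cardF : #|F| = q)
    (V : vectType F) (n : nat) (n_gt0 : 0 < n) (dimV : \dim {:V} = n)
    (b : n.-tuple V) (b_basis : basis_of {:V} b) :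
  (q = 2 -> 3 <= n -> location_number (nzc_graph b) = n) /\
  (3 <= q ->
     location_number (nzc_graph b) =
       \sum_(1 <= i < n.+1) 'C(n, i) * ((q - 1) ^ i - 1)).
Proof.
rewrite -cardF; split=> [F2 n3 | F3]; first exact: location_number_card2.
by rewrite location_number_card_ge3 // sum_bin_pred_exp // (leq_trans _ F3).
Qed.
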